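(* Let $p\in\,]0,1[$ be a constant. The expected rumor spreading time of the pull protocol with success probability $p$ on the complete graph with $n$ vertices is equal to $$\log_{1+p} n+\frac{1}{\ln\frac1{1-p}}\ln n\pm O(1).$$
   Context: Pull protocol with success probability $p$ on the complete graph with $n$ nodes: initially exactly one node is informed. In each round, every node that is uninformed at the beginning of the round calls a node chosen independently and uniformly at random from all $n$ nodes (including itself); each call independently is successful with probability $p$ and otherwise has no effect. If the call is successful and the called node was informed at the beginning of the round, then the caller is informed from the end of that round on. The rumor spreading time is the number of rounds until all nodes are informed. $\pm O(1)$ denotes a deviation bounded in absolute value by a constant independent of $n$ (possibly depending on $p$), for all sufficiently large $n$. *)

(* Defs.v *)
From mathcomp Require Import all_boot all_order all_algebra.
From mathcomp Require Import all_classical all_reals all_analysis.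

Set Implicit Arguments.
Unset Strict Implicit.
Unset Printing Implicit Defensive.

Import Order.TTheory GRing.Theory Num.Theory.
Import numFieldNormedType.Exports.

Local Open Scope classical_set_scope.
Local Open Scope ring_scope.

(* Rounds are numbered from 0.  [x t v = (u, b)] means: in round [t], node [v]
   would call [u], and [b] tells whether that call is successful.  Calls are
   given for all nodes; [informed] makes no use of those of informed nodes. *)
Fixpoint informed (n : nat) (v0 : 'I_n) (x : nat -> 'I_n -> 'I_n * bool)
    (t : nat) : {set 'I_n} :=
  if t is s.+1 then
    let A := informed v0 x s in
    A :|: [set v in ~: A | ((x s v).1 \in A) && (x s v).2]%SET
  else [set v0]%SET.

(* The infimum of the empty set is +oo: the value if the rumor never reaches
   all nodes. *)
Definition spreading_time (R : realType) (n : nat) (v0 : 'I_n)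
    (x : nat -> 'I_n -> 'I_n * bool) : \bar R :=
  ereal_inf [set t%:R%:E | t in [set t | informed v0 x t = [set: 'I_n]%SET]].

(* [X t v] is a random variable with values in the finite set ['I_n * bool];
   the family is independent, the called node is uniform, and it is independent
   of the success of the call, which has probability [p]. *)
Record pull_calls (R : realType) (d : measure_display) (T : measurableType d)
    (P : probability T R) (p : R) (n : nat)
    (X : nat -> 'I_n -> T -> 'I_n * bool) : Prop := PullCalls {
  pull_calls_measurable : forall t v (B : {set 'I_n * bool}),
    measurable [set w | X t v w \in B];
  pull_calls_law : forall t v u (b : bool),
    P [set w | X t v w = (u, b)]
      = (n%:R^-1 * (if b then p else 1 - p))%:E;
  pull_calls_indep : forall (J : seq (nat * 'I_n))
      (B : nat * 'I_n -> {set 'I_n * bool}), uniq J ->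
    P [set w | forall j, j \in J -> X j.1 j.2 w \in B j]
      = (\prod_(j <- J) P [set w | X j.1 j.2 w \in B j])%E }.

Definition expected_spreading_time (R : realType) (d : measure_display)
    (T : measurableType d) (P : probability T R) (n : nat) (v0 : 'I_n)
    (X : nat -> 'I_n -> T -> 'I_n * bool) : \bar R :=
  \int[P]_w spreading_time R v0 (fun t v => X t v w).

(* Main.v *)
Require Import Defs.
From mathcomp Require Import all_boot all_order all_algebra.
From mathcomp Require Import all_classical all_reals all_analysis.
From mathcomp Require Import measurable_realfun.
From mathcomp Require Import ring lra zify.
Set Implicit Arguments.
Unset Strict Implicit.
Unset Printing Implicit Defensive.
Import Order.TTheory GRing.Theory Num.Theory.
Import numFieldNormedType.Exports.
Local Open Scope classical_set_scope.
Local Open Scope ring_scope.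

(* When k nodes are informed and u = n - k are not, the number of uninformed
   nodes after one round is binomial with parameters u and 1 - p k / n.  Put
   a = 1 / ln (1 + p) and b = 1 / ln (1 / (1 - p)).  The potential
   a ln (n / k) + b ln (u + 1) decreases on average by about 1 per round; with
   x = k / n its drift is -1 up to errors of order x (1 - x), 1 / k (growth phase)
   and 1 / (u + 1) (shrinking phase).  Each error is the drift of a bounded
   function (x, 1 / k and 1 / (u + 1), respectively), so bounded corrections turn
   the potential into a submartingale or a supermartingale after adding the
   elapsed time, which bounds the expected time from below and from above. *)

(** * Binomial expectations *)

(* The expectation of [g B] for [B] binomial with parameters [u] and [q]. *)
Definition bexp (R : realType) (u : nat) (q : R) (g : nat -> R) : R :=
  \sum_(j < u.+1) 'C(u, j)%:R * q ^+ j * (1 - q) ^+ (u - j) * g j.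

Section Bexp.
Variable R : realType.
Implicit Types (q : R) (g h : nat -> R) (u : nat).

Lemma bexp_cst u q (c : R) : bexp u q (fun=> c) = c.
Proof.
rewrite /bexp -mulr_suml -[RHS]mul1r; congr (_ * _).
transitivity ((1 - q + q) ^+ u); last by rewrite subrK expr1n.
rewrite exprDn; apply: eq_bigr => j _.
by rewrite -[RHS]mulr_natl -mulrA (mulrC (q ^+ j)).
Qed.

Lemma bexpD u q g h : bexp u q (fun j => g j + h j) = bexp u q g + bexp u q h.
Proof. by rewrite /bexp -big_split; apply: eq_bigr => j _; rewrite mulrDr. Qed.

Lemma bexpZ u q c g : bexp u q (fun j => c * g j) = c * bexp u q g.
Proof. by rewrite /bexp mulr_sumr; apply: eq_bigr => j _; rewrite mulrCA. Qed.

Lemma eq_bexp u q g h :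
  (forall j, (j <= u)%N -> g j = h j) -> bexp u q g = bexp u q h.
Proof. by move=> gh; apply: eq_bigr => j _; rewrite gh // -ltnS. Qed.

Lemma ler_bexp u q g h : 0 <= q <= 1 ->
  (forall j, (j <= u)%N -> g j <= h j) -> bexp u q g <= bexp u q h.
Proof.
move=> /andP[q0 q1] gh; apply: ler_sum => j _; apply: ler_wpM2l.
  by rewrite !mulr_ge0// exprn_ge0// subr_ge0.
by rewrite gh // -ltnS.
Qed.

(* The size-biased binomial law with parameters (u + 1, q) is that of 1 + B,
   for B binomial with parameters (u, q). *)
Lemma bexp_size_bias u q g :
  bexp u.+1 q (fun j => j%:R * g j) = u.+1%:R * q * bexp u q (fun j => g j.+1).
Proof.
rewrite /bexp big_ord_recl /= mul0r mulr0 add0r mulr_sumr.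
apply: eq_bigr => j _; rewrite /bump /= add1n subSS exprS.
have := congr1 (fun m => m%:R : R) (mul_bin_diag u.+1 j).
rewrite /= !natrM => E.
rewrite -[RHS]mulrA.
transitivity ((j.+1%:R * 'C(u.+1, j.+1)%:R) * (q * q ^+ j * (1 - q) ^+ (u - j) * g j.+1)).
  ring.
rewrite -E; ring.
Qed.

Lemma bexp_mean u q : bexp u q (fun j => j%:R) = u%:R * q.
Proof.
case: u => [|u]; first by rewrite /bexp big_ord1 /= mulr0 mul0r.
have := bexp_size_bias u q (fun=> 1).
by rewrite bexp_cst mulr1 => <-; apply: eq_bexp => j _; rewrite mulr1.
Qed.

Lemma bexp_variance u q :
  bexp u q (fun j => (j%:R - u%:R * q) ^+ 2) = u%:R * q * (1 - q).
Proof.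
have sq : bexp u q (fun j => j%:R * j%:R) = u%:R * q * (u%:R * q + 1 - q).
  case: u => [|u]; first by rewrite /bexp big_ord1 /= !(mulr0, mul0r).
  rewrite (bexp_size_bias u q (fun j => j%:R)).
  rewrite (@eq_bexp u q _ (fun j => j%:R + 1)); last by move=> j _; rewrite natr1.
  by rewrite bexpD bexp_cst bexp_mean -natr1; ring.
rewrite (@eq_bexp u q _ (fun j => j%:R * j%:R
  + ((- 2 * (u%:R * q)) * j%:R + (u%:R * q) ^+ 2))); last by move=> j _; ring.
by rewrite !bexpD bexpZ bexp_cst bexp_mean sq; ring.
Qed.

(** For [B] binomial with parameters (u + 1, q), size-biasing turns [q (u + 1)] times the left side
    into the mean of [B / B], that is, the probability that [B > 0]. *)
Lemma bexp_inv_le u q : 0 < q <= 1 ->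
  bexp u q (fun j => (j.+1%:R)^-1) <= (q * u.+1%:R)^-1.
Proof.
move=> /andP[q0 q1].
rewrite -[leRHS]mul1r ler_pdivlMr ?mulr_gt0//.
rewrite mulrC (mulrC q) -(bexp_size_bias u q (fun j => j%:R^-1)).
rewrite -[leRHS](bexp_cst u.+1 q); apply: ler_bexp; first by rewrite (ltW q0) q1.
(* At 0 the product [0 * 0^-1] is 0, still at most 1. *)
by case=> [|j] _ /=; rewrite ?mul0r ?ler01 ?divff ?pnatr_eq0.
Qed.
End Bexp.

(** * Jensen's inequality for the logarithm and the inverse *)

Section Jensen.
Variable R : realType.
Implicit Types (q x z m : R) (g : nat -> R) (u : nat).

Lemma ln_le_subr1 x : 0 < x -> ln x <= x - 1.
Proof.
move=> x0; have := @le_ln1Dx R (x - 1).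
have -> : 1 + (x - 1) = x by ring.
by apply; lra.
Qed.

Lemma ln_tangent z m : 0 < z -> 0 < m -> ln z <= ln m + (m^-1 * z - 1).
Proof.
move=> z0 m0; rewrite -lerBlDl -ln_div ?posrE// [z / m]mulrC.
by apply: ln_le_subr1; rewrite mulr_gt0 ?invr_gt0.
Qed.

Lemma bexp_gt0 u q g : 0 <= q <= 1 ->
  (forall j, (j <= u)%N -> 0 < g j) -> 0 < bexp u q g.
Proof.
move=> q01 g0; pose e := \big[Num.min/g 0%N]_(j < u.+1) g j.
have e0 : 0 < e by apply: lt_bigmin => [|j _]; apply: g0; rewrite // -ltnS.
apply: (lt_le_trans e0); rewrite -[leLHS](bexp_cst u q); apply: ler_bexp => // j ju.
by rewrite /e (bigD1 (Ordinal (ju : (j < u.+1)%N)))//= ge_min lexx.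
Qed.

(** The tangent of [ln] at the mean [m] of [g] lies above [ln], and its expectation is [ln m]. *)
Lemma bexp_ln_le u q g : 0 <= q <= 1 ->
  (forall j, (j <= u)%N -> 0 < g j) ->
  bexp u q (fun j => ln (g j)) <= ln (bexp u q g).
Proof.
move=> q01 g0; set m := bexp u q g; have m0 : 0 < m by exact: bexp_gt0.
apply: (@le_trans _ _ (bexp u q (fun j => ln m + (m^-1 * g j + -1)))).
  by apply: ler_bexp => // j ju; apply: ln_tangent => //; exact: g0.
by rewrite !bexpD !bexp_cst bexpZ -/m mulVf ?gt_eqF// subrr addr0.
Qed.

(** The tangent of [1 / z] at the mean [m] is [2 / m - z / m ^ 2]; it lies below by
    [(1 - z / m) ^ 2 / z]. *)
Lemma bexp_inv_ge u q g : 0 <= q <= 1 ->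
  (forall j, (j <= u)%N -> 0 < g j) ->
  (bexp u q g)^-1 <= bexp u q (fun j => (g j)^-1).
Proof.
move=> q01 g0; set m := bexp u q g; have m0 : 0 < m by exact: bexp_gt0.
apply: (@le_trans _ _ (bexp u q (fun j => 2 / m + (- m^-1 ^+ 2) * g j))).
  rewrite bexpD bexp_cst bexpZ -/m.
  suff -> : 2 / m + - m^-1 ^+ 2 * m = m^-1 by [].
  by field; rewrite gt_eqF.
apply: ler_bexp => // j ju; have z0 := g0 _ ju.
rewrite -subr_ge0.
suff -> : (g j)^-1 - (2 / m + - m^-1 ^+ 2 * g j) = (g j)^-1 * (1 - g j / m) ^+ 2.
  by rewrite mulr_ge0 ?sqr_ge0// invr_ge0 ltW.
by field; rewrite !gt_eqF.
Qed.

End Jensen.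

(** * Deterministic speed of the logarithmic potential *)

Section Logs.
Variable R : realType.

(** If [y <= 1/2], then [C y <= 2 C y (1 - y)]; otherwise [1 - y <= 2 C y (1 - y)]. The error
    vanishes at both ends, as the drift of [x] does. *)
Lemma le_parabola (C y f : R) : 1 <= C -> 0 <= y -> y <= 1 -> f <= 1 ->
  f <= C * y -> f <= y + 2 * C * (y * (1 - y)).
Proof. by move=> C1 y0 y1 f1 fC; have [h|h] := lerP y (1/2); nra. Qed.

(* That is, [a = 1 / ln (1 + p)] and [b = 1 / ln (1 / (1 - p))]. *)
Definition rates (p a b : R) :=
  [/\ 0 < p, p < 1, a * ln (1 + p) = 1 & b * ln (1 - p) = -1].

Lemma growth_rate_gt0 (p a b : R) : rates p a b -> 0 < a.
Proof.
move=> [p0 p1 Ha _].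
have l0 : 0 < ln (1 + p) by apply: ln_gt0; lra.
by rewrite -(pmulr_lgt0 _ l0) Ha.
Qed.

Lemma shrink_rate_gt0 (p a b : R) : rates p a b -> 0 < b.
Proof.
move=> [p0 p1 _ Hb].
have l0 : ln (1 - p) < 0 by apply: ln_lt0; lra.
by rewrite -(nmulr_llt0 _ l0) Hb ltrN10.
Qed.

(** Like [shrink_rate_ge], this provides the hypothesis [1 <= C] of [le_parabola]. *)
Lemma growth_rate_ge (p a b : R) : rates p a b -> 1 <= a * p.
Proof.
move=> r; have a0 := growth_rate_gt0 r; case: r => [p0 p1 Ha _].
rewrite -[leLHS]Ha ler_wpM2l ?(ltW a0)//.
by have := @ln_le_subr1 R (1 + p); lra.
Qed.

Lemma shrink_rate_ge (p a b : R) : rates p a b -> 1 <= b * (p / (1 - p)).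
Proof.
move=> r; have b0 := shrink_rate_gt0 r; case: r => [p0 p1 _ Hb].
rewrite [leLHS](_ : 1 = b * (- ln (1 - p))); last by rewrite mulrN Hb opprK.
rewrite ler_wpM2l ?(ltW b0)// -lnV ?posrE; last by lra.
have -> : p / (1 - p) = (1 - p)^-1 - 1 by field; lra.
by apply: ln_le_subr1; rewrite invr_gt0; lra.
Qed.

(** The left side is the fall of the potential when [k] is multiplied by [1 + p (1 - x)] and [u + 1]
    by [1 - p x]. It equals 1 at [x = 0] and at [x = 1]; [le_parabola] bounds its two terms by
    [1 - x] and [x], up to multiples of [x (1 - x)]. *)
Lemma log_speed_le (p a b x : R) : rates p a b -> 0 <= x <= 1 ->
  a * ln (1 + p * (1 - x)) - b * ln (1 - p * x) <= 1 + 2 * (a + b / (1 - p)) * p * (x * (1 - x)).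
Proof.
move=> r; have ap1 := growth_rate_ge r; have bp1 := shrink_rate_ge r.
have a0 := growth_rate_gt0 r; have b0 := shrink_rate_gt0 r.
case: r => [p0 p1 Ha Hb] /andP[x0 x1].
have A : a * ln (1 + p * (1 - x)) <= 1 - x + 2 * (a * p) * ((1 - x) * (1 - (1 - x))).
  apply: le_parabola; [by []|lra|lra| |].
    by rewrite -[leRHS]Ha ler_wpM2l ?(ltW a0)// ler_ln ?posrE; nra.
  rewrite -mulrA ler_wpM2l ?(ltW a0)//.
  by have := @ln_le_subr1 R (1 + p * (1 - x)); nra.
have B : - (b * ln (1 - p * x)) <= x + 2 * (b * (p / (1 - p))) * (x * (1 - x)).
  apply: le_parabola; [by []|lra|lra| |].
    by rewrite lerNl -Hb ler_wpM2l ?(ltW b0)// ler_ln ?posrE; nra.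
  have px : 0 < 1 - p * x by nra.
  rewrite -mulrN -mulrA ler_wpM2l ?(ltW b0)// -lnV ?posrE//.
  apply: (@le_trans _ _ ((1 - p * x)^-1 - 1)).
    by apply: ln_le_subr1; rewrite invr_gt0.
  have -> : (1 - p * x)^-1 - 1 = p * x * (1 - p * x)^-1 by field; rewrite gt_eqF.
  rewrite [leRHS]mulrAC ler_wpM2l//; first by nra.
  by rewrite lef_pV2 ?posrE//; nra.
have -> : 1 + 2 * (a + b / (1 - p)) * p * (x * (1 - x)) = 1 - x + 2 * (a * p) * ((1 - x) * (1 - (1 - x)))
  + (x + 2 * (b * (p / (1 - p))) * (x * (1 - x))) by ring.
by rewrite lerD.
Qed.

(** As [le_parabola] bounds from above, it is applied to the amounts by which the two terms fall
    short of 1; this exchanges the roles of [x] and [1 - x]. *)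
Lemma log_speed_ge (p a b x : R) : rates p a b -> 0 <= x <= 1 ->
  1 - 2 * (a + b / (1 - p)) * p * (x * (1 - x)) <= a * ln (1 + p * (1 - x)) - b * ln (1 - p * x).
Proof.
move=> r; have ap1 := growth_rate_ge r; have bp1 := shrink_rate_ge r.
have a0 := growth_rate_gt0 r; have b0 := shrink_rate_gt0 r.
case: r => [p0 p1 Ha Hb] /andP[x0 x1].
have A : 1 - a * ln (1 + p * (1 - x)) <= x + 2 * (a * p) * (x * (1 - x)).
  apply: le_parabola; [by []|lra|lra| |].
    by rewrite lerBlDr lerDl mulr_ge0 ?(ltW a0)// ln_ge0//; nra.
  have z0 : 0 < 1 + p * (1 - x) by nra.
  rewrite -{1}Ha -mulrBr -mulrA ler_wpM2l ?(ltW a0)// -ln_div ?posrE//; last by lra.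
  apply: (@le_trans _ _ ((1 + p) / (1 + p * (1 - x)) - 1)).
    by apply: ln_le_subr1; rewrite divr_gt0//; lra.
  have -> : (1 + p) / (1 + p * (1 - x)) - 1 = (p * x) / (1 + p * (1 - x)).
    by field; rewrite gt_eqF.
  by rewrite ler_pdivrMr// ler_peMr//; nra.
have B : 1 + b * ln (1 - p * x) <=
    1 - x + 2 * (b * (p / (1 - p))) * ((1 - x) * (1 - (1 - x))).
  have px : 0 < 1 - p * x by nra.
  apply: le_parabola; [by []|lra|lra| |].
    by rewrite gerDl mulr_ge0_le0 ?(ltW b0)// ln_le0//; nra.
  have {1}-> : 1 = - (b * ln (1 - p)) by rewrite Hb opprK.
  rewrite addrC -mulrBr -mulrA ler_wpM2l ?(ltW b0)// -ln_div ?posrE//; last by lra.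
  apply: (@le_trans _ _ ((1 - p * x) / (1 - p) - 1)).
    by apply: ln_le_subr1; rewrite divr_gt0//; lra.
  by rewrite le_eqVlt; apply/orP; left; apply/eqP; field; lra.
have E : 1 - 2 * (a + b / (1 - p)) * p * (x * (1 - x)) = 1 - (x + 2 * (a * p) * (x * (1 - x)))
  - (1 - x + 2 * (b * (p / (1 - p))) * ((1 - x) * (1 - (1 - x)))) + 1
  by ring.
by rewrite E; lra.
Qed.

End Logs.

(** * One-round drift of the potentials *)

Section Drift.
Variable R : realType.

(* The probability that a node stays uninformed when [u] nodes are uninformed. *)
Definition miss (p : R) (n u : nat) : R := 1 - p * ((n - u)%:R / n%:R).

(* The argument [j] of both potentials counts the uninformed nodes; the constant
   [a * ln n%:R] is left out. *)
Definition lower_potential (p a b : R) (n j : nat) : R :=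
  - a * ln (n - j)%:R + (b * ln j.+1%:R
    + 2 * (a + b / (1 - p)) * ((n - j)%:R / n%:R)).

Definition upper_potential (p a b : R) (n j : nat) : R :=
  (- a * ln (n - j)%:R + 3 * a / p * (n - j)%:R^-1)
  + ((b * ln j.+1%:R + - (2 * b / (1 - p)) * j.+1%:R^-1)
    + - (2 * (a + b / (1 - p))) * ((n - j)%:R / n%:R)).

Section Round.
Variables (p a b : R) (n u : nat).
Hypotheses (r : rates p a b) (u0 : (0 < u)%N) (un : (u < n)%N).

Let k := (n - u)%:R : R.
Let x := k / n%:R.
Let q := miss p n u.
Let m := k * (1 + p * (1 - x)).

Lemma fraction_facts : [/\ 0 < x < 1, 0 < n%:R :> R, u%:R = n%:R * (1 - x) & k = n%:R * x].
Proof.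
have n0 : 0 < n%:R :> R by rewrite ltr0n; lia.
have kE : k = n%:R * x by rewrite /x; field; rewrite gt_eqF.
have knu : k = n%:R - u%:R by rewrite /k natrB// ltnW.
split => //; last by rewrite mulrBr -kE knu; ring.
rewrite /x divr_gt0//=; last by rewrite /k ltr0n; lia.
by rewrite ltr_pdivrMr// mul1r /k ltr_nat; lia.
Qed.

Lemma miss_bounds : 0 < q <= 1.
Proof.
have [/andP[x0 x1] _ _ _] := fraction_facts; case: r => [p0 p1 _ _].
by rewrite /q /miss -/k -/x; nra.
Qed.

Let q01 : 0 <= q <= 1.
Proof. by case/andP: miss_bounds => q0 ->; rewrite ltW. Qed.

Lemma informed_ge1 : 1 <= k. Proof. by rewrite /k ler1n; lia. Qed.

Lemma mean_informed : bexp u q (fun j => (n - j)%:R) = m.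
Proof.
have [_ n0 uE kE] := fraction_facts.
rewrite (@eq_bexp _ u q _ (fun j => n%:R + (-1) * j%:R)); last first.
  by move=> j ju; rewrite natrB ?mulN1r//; lia.
rewrite bexpD bexpZ bexp_cst bexp_mean uE /m kE /q /miss -/k -/x; ring.
Qed.

Lemma informed_gt0 j : (j <= u)%N -> 0 < (n - j)%:R :> R.
Proof. by move=> ju; rewrite ltr0n; lia. Qed.

(** Here [k (1 - x) = k u / n >= 1/2], as [k] and [u] are at least 1 with sum [n]. The margin above
    1 pays for the Jensen error in [growth_phase_upper]. *)
Lemma mean_informed_ge : 1 + p / 2 <= m.
Proof.
have [/andP[x0 x1] n0 uE kE] := fraction_facts; case: r => [p0 p1 _ _].
have k1 := informed_ge1.
suff : 1 <= 2 * (k * (1 - x)) by rewrite /m; nra.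
have -> : k * (1 - x) = (k * u%:R) / n%:R by rewrite uE; field; rewrite gt_eqF.
rewrite mulrA ler_pdivlMr// mul1r /k -!natrM ler_nat; nia.
Qed.

(* From the expansion 1/z = 1/m - (z - m)/m^2 + (z - m)^2/(m^2 z) at the mean m,
   where z >= k. *)
Lemma inv_informed_le :
  bexp u q (fun j => (n - j)%:R^-1) <= m^-1 * (1 + p * (1 - x) / m).
Proof.
have [/andP[x0 x1] n0 uE kE] := fraction_facts; case: (r) => [p0 p1 _ _].
have k1 := informed_ge1; have k0 : 0 < k by lra.
have m0 : 0 < m by have := mean_informed_ge; lra.
have ne j : (j <= u)%N -> (n - j)%:R = m - (j%:R - u%:R * q).
  move=> ju; rewrite natrB; last by lia.
  by rewrite /m kE uE /q /miss -/k -/x; ring.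
apply: (@le_trans _ _ (bexp u q (fun j => (m^-1 - m^-1 ^+ 2 * (u%:R * q)) +
   (m^-1 ^+ 2 * j%:R + (m^-1 ^+ 2 / k) * (j%:R - u%:R * q) ^+ 2)))).
  apply: ler_bexp => // j ju; rewrite ne//; have z0 := informed_gt0 ju.
  have kz : k <= m - (j%:R - u%:R * q) by rewrite -ne// /k ler_nat; lia.
  rewrite (ne _ ju) in z0.
  have [e eE] : exists e, e = j%:R - u%:R * q by eexists.
  rewrite -eE in kz z0 *.
  have -> : j%:R = e + u%:R * q by rewrite eE; ring.
  have -> : (m - e)^-1 = m^-1 + m^-1 ^+ 2 * e + m^-1 ^+ 2 * e ^+ 2 * (m - e)^-1.
    by field; rewrite !gt_eqF.
  have : m^-1 ^+ 2 * e ^+ 2 * (m - e)^-1 <= m^-1 ^+ 2 * e ^+ 2 * k^-1.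
    apply: ler_wpM2l; first by rewrite mulr_ge0 ?sqr_ge0.
    by rewrite lef_pV2.
  lra.
rewrite bexpD bexp_cst bexpD !bexpZ bexp_mean bexp_variance.
have -> : u%:R * q * (1 - q) = k * (p * (1 - x)) * q.
  by rewrite uE kE /q /miss -/k -/x; ring.
have -> : m^-1 - m^-1 ^+ 2 * (u%:R * q) +
  (m^-1 ^+ 2 * (u%:R * q) + m^-1 ^+ 2 / k * (k * (p * (1 - x)) * q)) =
  m^-1 * (1 + p * (1 - x) * q / m) by field; rewrite !gt_eqF.
rewrite ler_wpM2l ?invr_ge0 ?(ltW m0)// lerD2l ler_pM2r ?invr_gt0//.
by have /andP[q0 q1] := miss_bounds; rewrite ger_pMr//; nra.
Qed.

(** With [s = p (1 - x)], Jensen for [ln] applied to the inverse of the number of informed nodes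
    costs at most [a s / m]. The inverse itself falls from [(1 + s) / m] to at most
    [(1 + s / m) / m] on average, and [3 a / p] times this fall covers the cost. *)
Lemma growth_phase_upper :
  bexp u q (fun j => - a * ln (n - j)%:R + 3 * a / p * (n - j)%:R^-1) <=
  - a * ln k + 3 * a / p * k^-1 - a * ln (1 + p * (1 - x)).
Proof.
have a0 := growth_rate_gt0 r.
have [/andP[x0 x1] n0 uE kE] := fraction_facts; case: (r) => [p0 p1 _ _].
have k1 := informed_ge1; have k0 : 0 < k by lra.
have mge := mean_informed_ge; have m0 : 0 < m by lra.
have s0 : 0 < p * (1 - x) by nra.
have lnI : bexp u q (fun j => ln (n - j)%:R^-1) <= - ln m + p * (1 - x) / m.
  apply: (le_trans (bexp_ln_le q01 _)).
    by move=> j ju; rewrite invr_gt0 informed_gt0.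
  have t0 : 0 < 1 + p * (1 - x) / m by rewrite addr_gt0// divr_gt0.
  apply: (@le_trans _ _ (ln (m^-1 * (1 + p * (1 - x) / m)))).
    rewrite ler_ln ?posrE ?mulr_gt0 ?invr_gt0//; first exact: inv_informed_le.
    by apply: bexp_gt0 => // j ju; rewrite invr_gt0 informed_gt0.
  rewrite lnM ?posrE ?invr_gt0// lnV ?posrE// lerD2l.
  by have := ln_le_subr1 t0; lra.
have lnm : ln m = ln k + ln (1 + p * (1 - x)) by rewrite lnM ?posrE//; lra.
have iI := inv_informed_le.
rewrite (@eq_bexp _ u q _ (fun j => a * ln (n - j)%:R^-1
   + 3 * a / p * (n - j)%:R^-1)); last first.
  by move=> j ju; rewrite lnV ?posrE ?informed_gt0// mulrN mulNr.
rewrite bexpD !bexpZ.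
have ap0 : 0 < 3 * a / p by rewrite divr_gt0// mulr_gt0.
apply: (@le_trans _ _ (a * (- ln m + p * (1 - x) / m) +
   3 * a / p * (m^-1 * (1 + p * (1 - x) / m)))).
  by rewrite lerD// ler_wpM2l// ltW.
have kV : k^-1 = m^-1 * (1 + p * (1 - x)).
  by rewrite /m; field; rewrite !gt_eqF//; lra.
rewrite kV lnm.
suff : p * (1 - x) / m * (a + 3 * a / p / m) <= p * (1 - x) / m * (3 * a / p).
  lra.
rewrite ler_wpM2l ?divr_ge0 ?(ltW m0) ?(ltW s0)//.
have -> : a + 3 * a / p / m = a * (1 + 3 / p / m) by ring.
have -> : 3 * a / p = a * (3 / p) by ring.
rewrite ler_wpM2l ?(ltW a0)//.
have -> : 1 + 3 / p / m = (p * m + 3) / (p * m) by field; rewrite !gt_eqF.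
have pm0 : 0 < p * m by exact: mulr_gt0.
rewrite ler_pdivrMr//.
have -> : 3 / p * (p * m) = 3 * m by field; rewrite gt_eqF.
(* From [m >= 1 + p / 2] follows [(3 - p) m >= 3 + p (1 - p) / 2], so the constant 3 suffices. *)
nra.
Qed.

(** As [- ln] is convex, Jensen gives this direction without a correction. *)
Lemma growth_phase_lower :
  - a * ln k - a * ln (1 + p * (1 - x)) <= bexp u q (fun j => - a * ln (n - j)%:R).
Proof.
have a0 := growth_rate_gt0 r.
have [/andP[x0 x1] n0 uE kE] := fraction_facts; case: (r) => [p0 p1 _ _].
have k1 := informed_ge1; have k0 : 0 < k by lra.
have J := bexp_ln_le q01 informed_gt0.
rewrite mean_informed lnM ?posrE// in J; last by nra.
by rewrite bexpZ; nra.
Qed.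

(** The mean [u q + 1] exceeds [(u + 1) q] by [1 - q], which costs at most
    [b (1 - q) / ((1 - p) (u + 1))]. The mean of [1 / (B + 1)] exceeds [1 / (u + 1)] by at least
    [(1 - q) / (2 (u + 1))]; the factor [2 b / (1 - p)] balances the two. *)
Lemma shrink_phase_upper :
  bexp u q (fun j => b * ln j.+1%:R + - (2 * b / (1 - p)) * j.+1%:R^-1) <=
  b * ln u.+1%:R - 2 * b / (1 - p) * u.+1%:R^-1 + b * ln q.
Proof.
have b0 := shrink_rate_gt0 r.
have [/andP[x0 x1] n0 uE kE] := fraction_facts; case: (r) => [p0 p1 _ _].
have /andP[q0 q1] := miss_bounds.
have qp : 1 - p <= q by rewrite /q /miss -/k -/x; nra.
have mE : bexp u q (fun j => j.+1%:R) = u%:R * q + 1.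
  rewrite (@eq_bexp _ u q _ (fun j => j%:R + 1)); last by move=> j _; rewrite natr1.
  by rewrite bexpD bexp_cst bexp_mean.
have u1 : 1 <= u%:R :> R by rewrite ler1n.
have J1 : bexp u q (fun j => ln j.+1%:R) <= ln (u%:R * q + 1).
  by rewrite -mE; exact: bexp_ln_le.
have J2 : (u%:R * q + 1)^-1 <= bexp u q (fun j => j.+1%:R^-1).
  by rewrite -mE; exact: bexp_inv_ge.
have w0 : 0 < u%:R * q + 1 by nra.
have L : ln (u%:R * q + 1) <= ln u.+1%:R + ln q + (1 - q) / q / u.+1%:R.
  have -> : u%:R * q + 1 = u.+1%:R * (q * (1 + (1 - q) / q / u.+1%:R)).
    by rewrite -natr1; field; rewrite !gt_eqF//; lra.
  have t0 : 0 <= (1 - q) / q / u.+1%:R by rewrite !divr_ge0//; lra.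
  have t1 : 0 < 1 + (1 - q) / q / u.+1%:R by rewrite ltr_pwDl.
  rewrite lnM ?posrE ?mulr_gt0// lnM ?posrE//.
  rewrite addrA lerD2l; have := ln_le_subr1 t1.
  by rewrite addrAC subrr add0r.
(* The gain is [(1 - q) u / ((u + 1) (u q + 1))], and [u / (u q + 1) >= 1/2] because [u >= 1] and
   [q <= 1]. *)
have V : u.+1%:R^-1 + (1 - q) / 2 / u.+1%:R <= (u%:R * q + 1)^-1.
  rewrite -natr1 -subr_ge0.
  have -> : (u%:R * q + 1)^-1 - ((u%:R + 1)^-1 + (1 - q) / 2 / (u%:R + 1)) =
     (1 - q) * (2 * u%:R - (u%:R * q + 1)) / (2 * (u%:R + 1) * (u%:R * q + 1)).
    by field; rewrite !gt_eqF//; lra.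
  by rewrite divr_ge0// mulr_ge0//; nra.
have Q : (1 - q) / q / u.+1%:R <= (1 - q) / (1 - p) / u.+1%:R.
  by rewrite ler_wpM2r// ler_wpM2l ?lef_pV2 ?posrE//; lra.
rewrite bexpD !bexpZ.
have bp0 : 0 < 2 * b / (1 - p) by rewrite divr_gt0//; lra.
have : b * bexp u q (fun j => ln j.+1%:R) <=
   b * (ln u.+1%:R + ln q + (1 - q) / (1 - p) / u.+1%:R).
  by rewrite ler_wpM2l ?(ltW b0)// (le_trans J1)// (le_trans L)// lerD2l.
have : 2 * b / (1 - p) * (u.+1%:R^-1 + (1 - q) / 2 / u.+1%:R) <=
   2 * b / (1 - p) * bexp u q (fun j => j.+1%:R^-1).
  by rewrite ler_wpM2l ?(ltW bp0)// (le_trans V).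
by move: (ln u.+1%:R) (u.+1%:R^-1) => l U; lra.
Qed.

(* Jensen's inequality is applied to 1 / (B + 1), whose mean is nearly explicit,
   because applied to B + 1 it goes the wrong way. *)
Lemma shrink_phase_lower :
  b * ln u.+1%:R + b * ln q <= bexp u q (fun j => b * ln j.+1%:R).
Proof.
have b0 := shrink_rate_gt0 r.
have /andP[q0 q1] := miss_bounds.
have J : bexp u q (fun j => ln j.+1%:R^-1) <= - ln (q * u.+1%:R).
  have i0 j : (j <= u)%N -> 0 < j.+1%:R^-1 :> R by rewrite invr_gt0.
  apply: (le_trans (bexp_ln_le q01 i0)).
  rewrite -lnV ?posrE ?mulr_gt0// ler_ln ?posrE ?invr_gt0 ?mulr_gt0//.
    by apply: bexp_inv_le; rewrite q0 q1.
  exact: bexp_gt0.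
rewrite (@eq_bexp _ u q _ (fun j => - b * ln j.+1%:R^-1)); last first.
  by move=> j _; rewrite lnV ?posrE// mulNr mulrN opprK.
by rewrite bexpZ -mulrDr mulNr -mulrN ler_wpM2l ?(ltW b0)// lerNr addrC -lnM ?posrE.
Qed.

(** The drift [p x (1 - x)], times the coefficient [2 (a + b / (1 - p))] of [x] in the potentials,
    is exactly the error in [log_speed_le] and [log_speed_ge]. *)
Lemma mean_fraction : bexp u q (fun j => (n - j)%:R / n%:R) = x + p * (x * (1 - x)).
Proof.
have [_ n0 uE kE] := fraction_facts.
rewrite (@eq_bexp _ u q _ (fun j => n%:R^-1 * (n - j)%:R)); last first.
  by move=> j _; rewrite mulrC.
by rewrite bexpZ mean_informed /m kE; field; rewrite gt_eqF.
Qed.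

Lemma lower_drift :
  lower_potential p a b n u - 1 <= bexp u q (lower_potential p a b n).
Proof.
have [/andP[x0 x1] _ _ _] := fraction_facts.
have qE : 1 - p * x = q by [].
have x01 : 0 <= x <= 1 by rewrite (ltW x0) (ltW x1).
have S := log_speed_le r x01.
rewrite /lower_potential bexpD [X in _ <= _ + X]bexpD [X in _ <= _ + (_ + X)]bexpZ mean_fraction.
have := growth_phase_lower; have := shrink_phase_lower.
by rewrite -/k -/x; move: S; rewrite qE; lra.
Qed.

Lemma upper_drift :
  bexp u q (upper_potential p a b n) <= upper_potential p a b n u - 1.
Proof.
have [/andP[x0 x1] _ _ _] := fraction_facts.
have qE : 1 - p * x = q by [].
have x01 : 0 <= x <= 1 by rewrite (ltW x0) (ltW x1).
have S := log_speed_ge r x01.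
rewrite /upper_potential bexpD [X in _ + X <= _]bexpD [X in _ + (_ + X) <= _]bexpZ mean_fraction.
have := growth_phase_upper; have := shrink_phase_upper.
by rewrite -/k -/x; move: S; rewrite qE; move: (ln u.+1%:R) (u.+1%:R^-1) => l U; lra.
Qed.

End Round.
End Drift.

(** Grouping by cardinality later turns a sum over sets of uninformed nodes into a binomial
    expectation. *)
Lemma sum_subset_card (R : realType) (I : finType) (U : {set I}) (F : nat -> R) :
  \sum_(V : {set I} | V \subset U) F #|V| = \sum_(j < #|U|.+1) 'C(#|U|, j)%:R * F j.
Proof.
rewrite (partition_big (fun V : {set I} => inord #|V| : 'I_#|U|.+1) predT)//=.
apply: eq_bigr => j _.
rewrite (eq_bigl (fun V => V \in [set V : {set I} | (V \subset U) && (#|V| == j)]%SET)); last first.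
  move=> V; rewrite !inE; case VU: (V \subset U) => //=.
  have VU' : (#|V| < #|U|.+1)%N by rewrite ltnS subset_leq_card.
  rewrite -val_eqE /= inordK // VU.
rewrite (eq_bigr (fun=> F j)); last by move=> V; rewrite !inE => /andP[_ /eqP->].
by rewrite sumr_const cards_draws mulr_natl.
Qed.

(** * Independence of the current state from future calls *)

Section Chain.
Variables (R : realType) (d : measure_display) (T : measurableType d).
Variables (P : probability T R) (p : R) (n : nat) (v0 : 'I_n).
Variable X : nat -> 'I_n -> T -> 'I_n * bool.
Hypothesis HX : pull_calls P p X.

Definition pr (E : set T) : R := fine (P E).
Definition state (t : nat) (w : T) : {set 'I_n} := informed v0 (fun s v => X s v w) t.
Definition cyl (J : seq (nat * 'I_n)) (B : nat * 'I_n -> {set 'I_n * bool}) : set T :=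
  [set w | forall j, j \in J -> X j.1 j.2 w \in B j].

Lemma prE E : measurable E -> P E = (pr E)%:E.
Proof. by move=> mE; rewrite /pr fineK// fin_num_measure. Qed.

Lemma pr_ge0 E : 0 <= pr E. Proof. exact/fine_ge0/measure_ge0. Qed.

Lemma pr_setT : pr setT = 1. Proof. by rewrite /pr probability_setT. Qed.

Lemma pr_set0 : pr set0 = 0. Proof. by rewrite /pr measure0. Qed.

Lemma pr_mem_seq (F : finType) (Z : T -> F) (E : set T) (s : seq F) :
  (forall a, measurable (E `&` [set w | Z w = a])) -> uniq s ->
  measurable (E `&` [set w | Z w \in s]) /\
  pr (E `&` [set w | Z w \in s]) = \sum_(a <- s) pr (E `&` [set w | Z w = a]).
Proof.
move=> mZ; elim: s => [_|a s IH /= /andP[as_ us]].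
  have -> : E `&` [set w | Z w \in [::]] = set0 by rewrite -subset0 => w [].
  by split=> //; rewrite big_nil pr_set0.
have [ms es] := IH us.
have -> : E `&` [set w | Z w \in a :: s] =
    (E `&` [set w | Z w = a]) `|` (E `&` [set w | Z w \in s]).
  apply/seteqP; split => w /=.
    by move=> [Ew]; rewrite inE => /orP[/eqP|] H; [left|right].
  by move=> [[Ew ->]|[Ew H]]; split => //; rewrite inE ?eqxx ?H ?orbT.
split; first exact: measurableU.
rewrite big_cons -es /pr measureU//; last first.
  rewrite -subset0 => w [[_ /= ->] [_ /=]]; exact/negP.
by rewrite fineD// fin_num_measure.
Qed.

(** Measurability of [E] is obtained from the pieces, so that an induction on time can establish it
    together with the probability. *)
Lemma pr_partition (F : finType) (Z : T -> F) (E : set T) :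
  (forall a, measurable (E `&` [set w | Z w = a])) ->
  measurable E /\ pr E = \sum_a pr (E `&` [set w | Z w = a]).
Proof.
move=> mZ; have [] := pr_mem_seq mZ (index_enum_uniq F).
have -> : E `&` [set w | Z w \in index_enum F] = E.
  by apply/seteqP; split => [w []//|w Ew]; split => //=; exact: mem_index_enum.
by [].
Qed.

Lemma measurable_cyl J B : measurable (cyl J B).
Proof.
elim: J => [|j J IH].
  by rewrite (_ : cyl _ _ = setT)//; apply/seteqP; split => w.
have -> : cyl (j :: J) B = [set w | X j.1 j.2 w \in B j] `&` cyl J B.
  apply/seteqP; split => w /=.
    by move=> H; split => [|i iJ]; apply: H; rewrite inE ?eqxx ?iJ ?orbT.
  by move=> [H1 H2] i; rewrite inE => /orP[/eqP->|/H2].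
by apply: measurableI => //; exact: (pull_calls_measurable HX).
Qed.

Lemma pr_cyl J B : uniq J ->
  pr (cyl J B) = \prod_(j <- J) pr [set w | X j.1 j.2 w \in B j].
Proof.
move=> uJ; rewrite /pr /cyl (pull_calls_indep HX)//.
rewrite (eq_bigr (fun j => (pr [set w | X j.1 j.2 w \in B j])%:E)); last first.
  by move=> j _; apply: prE; exact: (pull_calls_measurable HX).
by rewrite prodEFin.
Qed.

Definition hits (A : {set 'I_n}) : {set 'I_n * bool} := [set z | (z.1 \in A) && z.2]%SET.

(* The calls of [v] compatible with the set of informed nodes passing from [A]
   to [A']. *)
Definition fate (A A' : {set 'I_n}) (v : 'I_n) : {set 'I_n * bool} :=
  if v \in A then [set: 'I_n * bool]%SET
  else if v \in A' then hits A else (~: hits A)%SET.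

Definition row (t : nat) : seq (nat * 'I_n) := [seq (t, v) | v <- enum 'I_n].

Lemma mem_row t j : (j \in row t) = (j.1 == t).
Proof.
case: j => s v /=; apply/mapP/eqP => [[v' _ [-> _]]//|->].
by exists v => //; rewrite mem_enum.
Qed.

Lemma uniq_row t : uniq (row t).
Proof. by rewrite map_inj_uniq ?enum_uniq// => v v' []. Qed.

(** Whether a node outside [A] becomes informed depends on its own call only, so a transition is one
    condition per call of the round. *)
Lemma state_step t w (A A' : {set 'I_n}) : state t w = A ->
  state t.+1 w = A' <->
  A \subset A' /\ (forall j, j \in row t -> X j.1 j.2 w \in fate A A' j.2).
Proof.
move=> sA; rewrite /state /= -/(state t w) sA.
split.
  move=> <-; split; first exact: finset.subsetUl.
  move=> [s v]; rewrite mem_row /= => /eqP->.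
  rewrite /fate; case vA: (v \in A); first by rewrite inE.
  by rewrite !inE vA /=; case: ifP; rewrite !inE => ->.
move=> [/fintype.subsetP AA' H]; apply/finset.setP => v; rewrite !inE.
case vA: (v \in A) => /=; first by rewrite AA'.
have := H (t, v); rewrite mem_row eqxx /= => /(_ isT).
by rewrite /fate vA; case: ifP => _; rewrite !inE => // /negbTE.
Qed.

Definition future (t : nat) (J : seq (nat * 'I_n)) := uniq J && all (fun j => t <= j.1)%N J.

(* The transition at time [t] is itself a cylinder event, which joins the future
   one; this lets independence propagate by induction on [t]. *)
Lemma state_step_set t (A A' : {set 'I_n}) J B :
  future t.+1 J ->
  ([set w | state t.+1 w = A'] `&` cyl J B) `&` [set w | state t w = A] =
  if A \subset A' then [set w | state t w = A] `&`
      cyl (row t ++ J) (fun j => if j.1 == t then fate A A' j.2 else B j)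
  else set0.
Proof.
move=> /andP[_ /allP Jt].
have Jn j : j \in J -> (j.1 == t) = false.
  by move=> /Jt jt; apply/negbTE; rewrite neq_ltn jt orbT.
case: ifP => AA'; apply/seteqP; split => w //=.
- move=> [[s' cJ] sA]; split => // j; rewrite mem_cat => /orP[jr|jJ].
    have jt := jr; rewrite mem_row in jt; rewrite jt.
    by have [/(_ s')[_ H] _] := state_step A' sA; exact: H.
  by rewrite Jn//; exact: cJ.
- move=> [sA H]; split => //; split.
    apply/(state_step A' sA); split => // j jr.
    have jt := jr; rewrite mem_row in jt.
    by have := H j; rewrite mem_cat jr jt; exact.
  by move=> j jJ; have := H j; rewrite mem_cat jJ orbT Jn//; exact.
- by move=> [[s' _] sA]; have [/(_ s')[]] := state_step A' sA; rewrite AA'.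
Qed.

(** The state at time [t] depends on earlier calls only. In the induction, splitting by the previous
    state makes the last transition a cylinder on [row t], and [row t ++ J] is again a list of
    future calls. *)
Lemma state_indep t A J B : future t J ->
  measurable [set w | state t w = A] /\
  pr ([set w | state t w = A] `&` cyl J B) =
  pr [set w | state t w = A] * \prod_(j <- J) pr [set w | X j.1 j.2 w \in B j].
Proof.
elim: t A J B => [|t IH] A' J B fJ.
  have /andP[uJ _] := fJ.
  have [e|e] := eqVneq A' [set v0]%SET.
    have -> : [set w | state 0 w = A'] = setT.
      by apply/seteqP; split => w //= _; rewrite e.
    by rewrite setTI pr_setT mul1r pr_cyl.
  have -> : [set w | state 0 w = A'] = set0.
    by rewrite -subset0 => w /= E; rewrite -E eqxx in e.
  by rewrite set0I pr_set0 mul0r.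
have step J' B' : future t.+1 J' ->
    measurable ([set w | state t.+1 w = A'] `&` cyl J' B') /\
    pr ([set w | state t.+1 w = A'] `&` cyl J' B') =
    (\sum_(A : {set 'I_n} | A \subset A') pr [set w | state t w = A] *
       \prod_(j <- row t) pr [set w | X j.1 j.2 w \in fate A A' j.2]) *
    \prod_(j <- J') pr [set w | X j.1 j.2 w \in B' j].
  move=> fJ'; have /andP[uJ' /allP aJ'] := fJ'.
  have Jn j : j \in J' -> (j.1 == t) = false.
    by move=> /aJ' jt; apply/negbTE; rewrite neq_ltn jt orbT.
  have fr : future t (row t ++ J').
    apply/andP; split.
      rewrite cat_uniq uniq_row uJ' andbT /=; apply/hasPn => j /Jn jt.
      by rewrite /= mem_row jt.
    apply/allP => j; rewrite mem_cat mem_row => /orP[/eqP->//|/aJ'].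
    exact: ltnW.
  have [|mE ->] := @pr_partition _ (state t) ([set w | state t.+1 w = A'] `&` cyl J' B').
    move=> A; rewrite state_step_set//; case: ifP => // _.
    have [mA _] := IH A [::] (fun=> [set: 'I_n * bool]%SET) isT.
    by apply: measurableI => //; exact: measurable_cyl.
  split => //; rewrite mulr_suml [RHS]big_mkcond/=; apply: eq_bigr => A _.
  rewrite state_step_set//; case: ifP => _; last exact: pr_set0.
  have [_ ->] := IH A _ (fun j => if j.1 == t then fate A A' j.2 else B' j) fr.
  rewrite big_cat mulrA /=; congr (_ * _ * _).
    apply: eq_big_seq => j; rewrite mem_row => /eqP jt.
    by rewrite jt eqxx.
  by apply: eq_big_seq => j jJ; rewrite Jn.
have nilE : [set w | state t.+1 w = A'] `&` cyl [::] (fun=> [set: 'I_n * bool]%SET) =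
    [set w | state t.+1 w = A'].
  by apply/seteqP; split => w //= [].
(* The empty list identifies the sum in [step] as the probability of the state. *)
have [] := step [::] (fun=> [set: 'I_n * bool]%SET) isT.
rewrite nilE big_nil mulr1 => mA eA; split => //.
by have [_ ->] := step J B fJ; rewrite eA.
Qed.

Lemma measurable_state t A : measurable [set w | state t w = A].
Proof. by have [] := @state_indep t A [::] (fun=> [set: 'I_n * bool]%SET) isT. Qed.

Lemma pr_call t v (S : {set 'I_n * bool}) :
  pr [set w | X t v w \in S] = \sum_(z in S) n%:R^-1 * (if z.2 then p else 1 - p).
Proof.
have mZ z : measurable (setT `&` [set w | X t v w = z]).
  rewrite setTI; have := pull_calls_measurable HX t v [set z]%SET.
  rewrite (_ : [set w | _] = [set w | X t v w = z])//.
  by apply/seteqP; split => w /=; rewrite inE => /eqP.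
have [_] := pr_mem_seq mZ (enum_uniq S).
rewrite setTI big_enum/=.
have -> : [set w | X t v w \in enum S] = [set w | X t v w \in S].
  by apply/seteqP; split => w /=; rewrite mem_enum.
move=> ->; apply: eq_bigr => -[u b] _.
by rewrite setTI /pr (pull_calls_law HX).
Qed.

Lemma pr_hits t v (A : {set 'I_n}) :
  pr [set w | X t v w \in hits A] = p * (#|A|%:R / n%:R).
Proof.
rewrite pr_call.
transitivity (\sum_(u in A) \sum_(b | b) n%:R^-1 * (if b then p else 1 - p)).
  rewrite pair_big_dep /=; apply: eq_big => [[u b]|[u b]] //=; by rewrite inE.
rewrite (eq_bigr (fun=> n%:R^-1 * p)); last first.
  by move=> u _; rewrite big_mkcond big_bool /= addr0.
by rewrite sumr_const -mulr_natl; ring.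
Qed.

Lemma pr_fate t v (A A' : {set 'I_n}) :
  pr [set w | X t v w \in fate A A' v] =
  if v \in A then 1 else if v \in A' then p * (#|A|%:R / n%:R)
  else 1 - p * (#|A|%:R / n%:R).
Proof.
rewrite /fate; case: ifP => _.
  rewrite (_ : [set w | _] = setT) ?pr_setT//.
  by apply/seteqP; split => w //= _; rewrite inE.
case: ifP => _; first exact: pr_hits.
rewrite -(pr_hits t v) (_ : [set w | _] = ~` [set w | X t v w \in hits A]); last first.
  by apply/seteqP; split => w /=; rewrite finset.in_setC => /negP.
have mh := pull_calls_measurable HX t v (hits A).
by rewrite /pr probability_setC// (prE mh) -EFinB.
Qed.

(** Nodes of [A] contribute 1, newly informed ones the success probability, the others its
    complement. The exponents count uninformed nodes, as in [bexp]. *)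
Lemma prod_fate t (A A' : {set 'I_n}) : A \subset A' ->
  \prod_(j <- row t) pr [set w | X j.1 j.2 w \in fate A A' j.2] =
  (p * (#|A|%:R / n%:R)) ^+ (#|~: A| - #|~: A'|)%N *
  (1 - p * (#|A|%:R / n%:R)) ^+ #|~: A'|.
Proof.
move=> AA'; rewrite big_map big_enum/=.
under eq_bigr do rewrite pr_fate.
rewrite (bigID (mem A))/= big1 ?mul1r; last by move=> v ->.
rewrite (bigID (mem A'))/=; congr (_ * _).
  rewrite (eq_bigr (fun=> p * (#|A|%:R / n%:R))); last first.
    by move=> v /andP[/negbTE-> ->].
  rewrite (eq_bigl (mem (A' :\: A)%SET)); last by move=> v; rewrite !inE.
  rewrite prodr_const cardsD (finset.setIidPr AA').
  suff -> : (#|A'| - #|A| = #|~: A| - #|~: A'|)%N by [].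
  by have := cardsC A; have := cardsC A'; have := subset_leq_card AA'; lia.
rewrite (eq_bigr (fun=> 1 - p * (#|A|%:R / n%:R))); last first.
  by move=> v /andP[/negbTE-> /negbTE->].
rewrite (eq_bigl (mem (~: A')%SET)) ?prodr_const//.
move=> v; rewrite !inE; case vA': (v \in A'); rewrite ?andbF//.
by rewrite andbT; apply: contraFN vA'; exact: (fintype.subsetP AA').
Qed.

Definition law (t : nat) (A : {set 'I_n}) : R := pr [set w | state t w = A].

(** * Distribution of the number of uninformed nodes *)

Lemma law_step t (A' : {set 'I_n}) :
  law t.+1 A' = \sum_(A : {set 'I_n} | A \subset A') law t A *
    ((p * (#|A|%:R / n%:R)) ^+ (#|~: A| - #|~: A'|)%N *
     (1 - p * (#|A|%:R / n%:R)) ^+ #|~: A'|).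
Proof.
rewrite /law.
have mZ A : measurable ([set w | state t.+1 w = A'] `&` [set w | state t w = A]).
  by apply: measurableI; exact: measurable_state.
have [_ ->] := pr_partition mZ.
rewrite [RHS]big_mkcond/=; apply: eq_bigr => A _.
have /(_ isT) := @state_step_set t A A' [::] (fun=> [set: 'I_n * bool]%SET).
rewrite (_ : cyl _ _ = setT); last by apply/seteqP; split.
rewrite setIT => ->; case: ifP => AA'; last exact: pr_set0.
have fr : future t (row t ++ [::]).
  rewrite cats0 /future uniq_row; apply/allP => j.
  by rewrite mem_row => /eqP->.
have [_ ->] := state_indep A (fun j => if j.1 == t then fate A A' j.2
   else [set: 'I_n * bool]%SET) fr.
rewrite cats0 -(prod_fate t AA'); congr (_ * _).
by apply: eq_big_seq => j; rewrite mem_row => ->.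
Qed.

(* The mean of [g] at the number of uninformed nodes. *)
Definition mean (t : nat) (g : nat -> R) : R :=
  \sum_(A : {set 'I_n}) law t A * g #|~: A|.

(** Given [A], each node of [~: A] stays uninformed independently with probability [miss], so the
    number of those that do is binomial. *)
Lemma mean_step t (g : nat -> R) :
  mean t.+1 g = mean t (fun u => bexp u (miss p n u) g).
Proof.
rewrite /mean.
under eq_bigr do rewrite law_step mulr_suml.
rewrite (exchange_big_dep predT)//=; apply: eq_bigr => A _.
under eq_bigr do rewrite -mulrA.
rewrite -mulr_sumr; congr (_ * _).
have kE : (n - #|~: A|)%N = #|A| by have := cardsC A; rewrite card_ord; lia.
rewrite /bexp /miss kE; set r := p * _.
rewrite (eq_bigr (fun j : 'I_ _ => 'C(#|~: A|, j)%:R *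
    ((1 - r) ^+ j * r ^+ (#|~: A| - j) * g j))); last first.
  by move=> j _; rewrite !mulrA; congr (_ * _ ^+ _ * _); rewrite subKr.
rewrite -(sum_subset_card _ (fun j => (1 - r) ^+ j * r ^+ (#|~: A| - j) * g j)).
rewrite (reindex_inj (inv_inj (@finset.setCK _)))/=.
apply: eq_big => [V|V _]; first by rewrite finset.subsetC.
by rewrite finset.setCK; ring.
Qed.

Lemma mean0 g : mean 0 g = g n.-1.
Proof.
rewrite /mean (bigD1 [set v0]%SET)//= big1 ?addr0; last first.
  move=> A Av; rewrite /law (_ : [set w | _] = set0) ?pr_set0 ?mul0r//.
  by rewrite -subset0 => w /= E; rewrite -E eqxx in Av.
rewrite /law (_ : [set w | _] = setT) ?pr_setT ?mul1r; last by apply/seteqP; split.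
suff -> : #|~: [set v0]%SET| = n.-1 by [].
by have := cardsC [set v0]%SET; rewrite cards1 card_ord; lia.
Qed.

Lemma law_ge0 t A : 0 <= law t A. Proof. exact: pr_ge0. Qed.

Lemma sum_law t : \sum_(A : {set 'I_n}) law t A = 1.
Proof.
have [|_] := @pr_partition _ (state t) setT.
  by move=> A; rewrite setTI; exact: measurable_state.
by rewrite pr_setT => ->; apply: eq_bigr => A _; rewrite setTI.
Qed.

Lemma law_eq0 t (A : {set 'I_n}) : v0 \notin A -> law t A = 0.
Proof.
move=> vA; rewrite /law (_ : [set w | _] = set0) ?pr_set0//.
rewrite -subset0 => w /= E; move: vA; rewrite -E => /negP; apply.
by rewrite /state; elim: t {E} => [|t IH] /=; rewrite !inE ?IH.
Qed.

(** The probability that the spreading time exceeds [t], since informed nodes stay informed. *)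
Definition tail (t : nat) : R := \sum_(A : {set 'I_n} | A != [set: 'I_n]%SET) law t A.

Lemma tailE t : P [set w | state t w != [set: 'I_n]%SET] = (tail t)%:E.
Proof.
have mZ A : measurable ([set w | state t w != [set: 'I_n]%SET] `&` [set w | state t w = A]).
  have [->|nA] := eqVneq A [set: 'I_n]%SET.
    rewrite (_ : _ `&` _ = set0)//; rewrite -subset0 => w /= [/negP H E].
    by apply: H; rewrite E.
  rewrite (_ : _ `&` _ = [set w | state t w = A]); first exact: measurable_state.
  by apply/seteqP; split => [w []//|w /= E]; split => //; rewrite E.
have [mE eE] := pr_partition mZ.
rewrite (prE mE) eE /tail [in RHS]big_mkcond /=; congr (_%:E).
apply: eq_bigr => A _; case: ifP => nA; last first.
  rewrite (_ : _ `&` _ = set0) ?pr_set0//; rewrite -subset0 => w /= [H E].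
  by move: H; rewrite E nA.
congr pr; apply/seteqP; split => w /=; first by case.
by move=> E; rewrite E nA.
Qed.

(** States without [v0] have probability 0, so at most [n - 1] nodes are uninformed. *)
Lemma ler_mean t (g h : nat -> R) : (forall u, (u < n)%N -> g u <= h u) ->
  mean t g <= mean t h.
Proof.
move=> gh; apply: ler_sum => A _.
have [vA|/law_eq0->] := boolP (v0 \in A); last by rewrite !mul0r.
apply: ler_wpM2l; first exact: law_ge0.
apply: gh; have := cardsC A; rewrite card_ord (cardsD1 v0) vA; lia.
Qed.

Lemma mean_tail t c : mean t (fun u => if u == 0%N then 0 else c) = tail t * c.
Proof.
rewrite /mean /tail mulr_suml [RHS]big_mkcond/=; apply: eq_bigr => A _.
rewrite cards_eq0 -[_ == finset.set0](inj_eq (inv_inj (@finset.setCK _))).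
by rewrite finset.setCK finset.setC0; case: eqP => //= _; rewrite mulr0.
Qed.

Lemma meanD t g h : mean t (fun u => g u + h u) = mean t g + mean t h.
Proof. by rewrite /mean -big_split; apply: eq_bigr => A _; rewrite mulrDr. Qed.

Lemma mean_cst t c : mean t (fun=> c) = c.
Proof. by rewrite /mean -mulr_suml sum_law mul1r. Qed.

End Chain.

(** * Series of nonnegative terms and first times *)

Lemma nneseries_le_ub (R : realType) (f : nat -> R) (M : R) :
  (forall t, 0 <= f t) -> (forall t, \sum_(0 <= s < t) f s <= M) ->
  (\sum_(0 <= t <oo) (f t)%:E <= M%:E)%E.
Proof.
move=> f0 fM; apply: lime_le; first by apply: is_cvg_nneseries => t _ _; rewrite lee_fin.
by apply: nearW => t; rewrite sumEFin lee_fin.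
Qed.

(** Once [a] holds it holds forever, so the times at which it fails are those before the first
    success. If it never holds, both sides are infinite. *)
Lemma first_time_series (R : realType) (a : pred nat) :
  (forall t, a t -> a t.+1) ->
  ereal_inf [set t%:R%:E | t in [set t | a t]] =
  (\sum_(0 <= t <oo) (~~ a t)%:R%:E)%E :> \bar R.
Proof.
move=> aS.
have f0 t : (0 <= (~~ a t)%:R%:E :> \bar R)%E by rewrite lee_fin.
have sum_id m : (forall s, (s < m)%N -> ~~ a s) ->
    (\sum_(0 <= t < m) (~~ a t)%:R%:E = m%:R%:E :> \bar R)%E.
  move=> na; rewrite sumEFin; congr (_%:E).
  rewrite big_nat (eq_bigr (fun=> 1)); last by move=> s /andP[_ /na ->].
  by rewrite -big_nat big_const_nat subn0 iter_addr_0.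
have [[t0 at0]|no] := pselect (exists t, a t); last first.
  have na t : ~~ a t by apply/negP => h; apply: no; exists t.
  rewrite (_ : [set t%:R%:E | t in _] = set0); last first.
    by rewrite -subset0 => _ /= [t at_ _]; rewrite (negbTE (na t)) in at_.
  rewrite ereal_inf0; apply/esym/eqyP => A _.
  apply: (@le_trans _ _ (\sum_(0 <= t < (Num.truncn A).+1) (~~ a t)%:R%:E)%E).
    by rewrite sum_id// lee_fin ltW// truncnS_gt.
  by apply: nneseries_lim_ge => t _ _.
have [m am mmin] := ex_minnP (ex_intro (fun t => a t) t0 at0).
have aE s : (m <= s)%N -> a s.
  elim: s => [|s IH]; first by rewrite leqn0 => /eqP <-.
  by rewrite leq_eqVlt => /predU1P[<-//|/IH/aS].
rewrite (nneseries_split _ m)//.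
rewrite add0n eseries0 ?adde0; last by move=> s ms _ /=; rewrite aE.
rewrite sum_id; last by move=> s sm; apply/negP => /mmin; rewrite leqNgt sm.
apply/le_anti/andP; split; first by apply: ereal_inf_lbound; exists m.
apply: le_ereal_inf_tmp => _ /= [s as_ <-]; rewrite lee_fin ler_nat; exact: mmin.
Qed.

(** * Values of the potentials at the start and in arbitrary states *)

Section PotentialBounds.
Variable R : realType.
Implicit Types (p a b : R) (n u : nat).

Lemma rates_coef_gt0 p a b : rates p a b ->
  [/\ 0 < 3 * a / p, 0 < 2 * b / (1 - p) & 0 < 2 * (a + b / (1 - p))].
Proof.
move=> r; have a0 := growth_rate_gt0 r; have b0 := shrink_rate_gt0 r.
case: r => [p0 p1 _ _]; have q0 : 0 < 1 - p by lra.
split; [by rewrite divr_gt0 ?mulr_gt0|by rewrite divr_gt0 ?mulr_gt0|].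
by rewrite mulr_gt0// ltr_pwDl// divr_ge0 ?ltW.
Qed.

Lemma fraction_bounds n u : (u < n)%N -> 0 <= ((n - u)%:R / n%:R : R) <= 1.
Proof.
move=> un; rewrite divr_ge0//= ler_pdivrMr ?ltr0n ?(leq_ltn_trans _ un)//.
by rewrite mul1r ler_nat leq_subr.
Qed.

Lemma ln_nat_bounds m n : (0 < m <= n)%N -> 0 <= (ln m%:R : R) <= ln n%:R.
Proof.
move=> /andP[m0 mn]; rewrite ln_ge0 ?ler1n//=.
by rewrite ler_ln ?ler_nat// posrE ltr0n// (leq_trans m0).
Qed.

Lemma inv_nat_bounds m : (0 < m)%N -> 0 <= (m%:R^-1 : R) <= 1.
Proof. by move=> m0; rewrite invr_ge0 ler0n invf_le1 ?ltr0n// ler1n. Qed.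

Lemma upper_potential_ge p a b n u : rates p a b -> (u < n)%N ->
  - a * ln n%:R - (2 * b / (1 - p) + 2 * (a + b / (1 - p)))
    <= upper_potential p a b n u.
Proof.
move=> r un; have a0 := growth_rate_gt0 r; have b0 := shrink_rate_gt0 r.
have [c10 c20 D0] := rates_coef_gt0 r; rewrite /upper_potential.
move: (3 * a / p) (2 * b / (1 - p)) (2 * (a + b / (1 - p))) c10 c20 D0 => c1 c2 D c10 c20 D0.
have /andP[_ f1] := fraction_bounds un.
have /andP[_ l1] : 0 <= (ln (n - u)%:R : R) <= ln n%:R.
  by apply: ln_nat_bounds; rewrite subn_gt0 un leq_subr.
have /andP[m0 _] : 0 <= (ln u.+1%:R : R) <= ln n%:R by exact: ln_nat_bounds.
have /andP[_ i1] := inv_nat_bounds (ltn0Sn u).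
have /andP[j0 _] : 0 <= ((n - u)%:R^-1 : R) <= 1.
  by apply: inv_nat_bounds; rewrite subn_gt0.
have := ler_wpM2l (ltW a0) l1; have := mulr_ge0 (ltW b0) m0.
have := ler_wpM2l (ltW c20) i1; have := mulr_ge0 (ltW c10) j0.
have := ler_wpM2l (ltW D0) f1.
rewrite !mulNr mulr1.
move: (a * _) (a * _) (b * _) (c2 * _) (c1 * _) (D * _) => x1 x2 x3 x4 x5 x6; lra.
Qed.

(** At the start [k = 1] and [n.-1.+1 = n], so only [b ln n] and bounded terms remain. *)
Lemma upper_potential_start p a b n : rates p a b -> (0 < n)%N ->
  upper_potential p a b n n.-1 <= b * ln n%:R + 3 * a / p.
Proof.
move=> r n0; have [c10 c20 D0] := rates_coef_gt0 r; rewrite /upper_potential.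
rewrite -subn1 subKn// subn1 prednK// ln1 invr1 div1r mulr0 mulr1 add0r.
move: (3 * a / p) (2 * b / (1 - p)) (2 * (a + b / (1 - p))) c10 c20 D0 => c1 c2 D c10 c20 D0.
have /andP[i0 _] := inv_nat_bounds n0.
have := mulr_ge0 (ltW c20) i0; have := mulr_ge0 (ltW D0) i0.
rewrite !mulNr; move: (b * _) (c2 * _) (D * _) => x1 x2 x3; lra.
Qed.

(** The first two terms are the value at [u = 0]. The excess in other states is of order [ln n]; it
    will be weighted by [tail t], which can be made small. *)
Lemma lower_potential_le p a b n u : rates p a b -> (u < n)%N ->
  lower_potential p a b n u <= - a * ln n%:R + 2 * (a + b / (1 - p)) +
    (if u == 0%N then 0 else (a + b) * ln n%:R + 1).
Proof.
move=> r un; have a0 := growth_rate_gt0 r; have b0 := shrink_rate_gt0 r.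
have [_ _ D0] := rates_coef_gt0 r; rewrite /lower_potential.
move: (2 * (a + b / (1 - p))) D0 => D D0.
have n0 : (0 < n)%N by exact: leq_ltn_trans un.
case: eqP => [->|_].
  by rewrite subn0 ln1 mulr0 add0r addr0 divff ?mulr1// pnatr_eq0 -lt0n.
have /andP[_ f1] := fraction_bounds un.
have /andP[l0 _] : 0 <= (ln (n - u)%:R : R) <= ln n%:R.
  by apply: ln_nat_bounds; rewrite subn_gt0 un leq_subr.
have /andP[_ m1] : 0 <= (ln u.+1%:R : R) <= ln n%:R by exact: ln_nat_bounds.
have := mulr_ge0 (ltW a0) l0; have := ler_wpM2l (ltW b0) m1.
have := ler_wpM2l (ltW D0) f1.
rewrite !mulNr mulr1 mulrDl.
move: (a * _) (a * _) (b * _) (b * _) (D * _) => x1 x2 x3 x4 x5; lra.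
Qed.

Lemma lower_potential_start p a b n : rates p a b -> (0 < n)%N ->
  b * ln n%:R <= lower_potential p a b n n.-1.
Proof.
move=> r n0; have [_ _ D0] := rates_coef_gt0 r; rewrite /lower_potential.
rewrite -subn1 subKn// subn1 prednK// ln1 div1r mulr0 add0r lerDl.
by rewrite mulr_ge0 ?(ltW D0)// invr_ge0.
Qed.

End PotentialBounds.

(** * From drift to expected spreading time *)

Section Expectation.
Variables (R : realType) (d : measure_display) (T : measurableType d).
Variables (P : probability T R) (p : R) (n : nat) (v0 : 'I_n).
Variable X : nat -> 'I_n -> T -> 'I_n * bool.
Hypothesis HX : pull_calls P p X.
Notation mean := (mean P v0 X).
Notation tail := (tail P v0 X).
Notation state := (state v0 X).

Lemma tail_ge0 t : 0 <= tail t.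
Proof. by apply: sumr_ge0 => A _; exact: law_ge0. Qed.

(** The spreading time is the number of rounds [t] at which the rumor is incomplete; the integral is
    exchanged with this series of indicators. *)
Lemma expected_spreading_time_series :
  expected_spreading_time P v0 X = (\sum_(0 <= t <oo) (tail t)%:E)%E.
Proof.
have mS t : measurable [set w | state t w != [set: 'I_n]%SET].
  rewrite (_ : [set w | _] = ~` [set w | state t w = [set: 'I_n]%SET]).
    by apply: measurableC; exact: measurable_state HX _ _.
  by apply/seteqP; split => w /= /eqP.
rewrite /expected_spreading_time.
under eq_integral => w _.
  rewrite /spreading_time.
  rewrite (_ : [set t | _] = [set t | informed v0 (fun t v => X t v w) t == [set: 'I_n]%SET]); last first.
    by apply/seteqP; split => t /= /eqP.
  rewrite (@first_time_series R (fun t => informed v0 (fun t v => X t v w) t == [set: 'I_n]%SET)); last first.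
    by move=> t /eqP /= ->; rewrite finset.setTU.
  rewrite -/(state _ _).
  over.
rewrite (eq_integral (fun w => \sum_(0 <= t <oo)
   (\1_[set w | state t w != [set: 'I_n]%SET] w)%:E)%E); last first.
  by move=> w _; apply: eq_eseriesr => t _; rewrite indicE mem_setE.
rewrite integral_nneseries//; last first.
  by move=> t; apply/measurable_realfun.measurable_EFinP; exact: measurable_indic.
apply: eq_eseriesr => t _.
by rewrite integral_indic// setIT; exact: (tailE v0 HX t).
Qed.

(** The sum of tails is the expected time elapsed up to [t], the clock stopping on completion.
    Potential plus this time does not decrease in mean. *)
Lemma mean_drift_ge t g :
  (forall u, (0 < u)%N -> (u < n)%N -> g u - 1 <= bexp u (miss p n u) g) ->
  g n.-1 <= mean t g + \sum_(0 <= s < t) tail s.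
Proof.
move=> dr; elim: t => [|t IH]; first by rewrite big_geq// addr0 (mean0 P v0 X).
rewrite big_nat_recr//= addrA (le_trans IH)// [leRHS]addrAC lerD2r.
rewrite (mean_step v0 HX) -lerBlDr -[tail t]mulr1 -mulrN -(mean_tail P v0 X) -meanD.
apply: ler_mean => u un.
case: u un => [|u] un; last exact: dr.
(* At [u = 0] the state is absorbing and no time is charged. *)
by rewrite eqxx addr0 /bexp big_ord1 /= !mul1r.
Qed.

Lemma mean_drift_le t g :
  (forall u, (0 < u)%N -> (u < n)%N -> bexp u (miss p n u) g <= g u - 1) ->
  mean t g + \sum_(0 <= s < t) tail s <= g n.-1.
Proof.
move=> dr; elim: t => [|t IH]; first by rewrite big_geq// addr0 (mean0 P v0 X).
rewrite big_nat_recr//= addrA (le_trans _ IH)// [leLHS]addrAC lerD2r.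
rewrite (mean_step v0 HX) -lerBrDr -[tail t]mulr1 -mulrN -(mean_tail P v0 X) -meanD.
apply: ler_mean => u un.
case: u un => [|u] un; last exact: dr.
by rewrite eqxx addr0 /bexp big_ord1 /= !mul1r.
Qed.

(** Otherwise more than [M / e] terms, each at least [e], would sum to more than [M]. *)
Lemma tail_small (M e : R) : (forall t, \sum_(0 <= s < t) tail s <= M) ->
  0 < e -> exists t, tail t < e.
Proof.
move=> SM e0; apply: contrapT => no.
have te t : e <= tail t by rewrite leNgt; apply/negP => h; apply: no; exists t.
have := SM (Num.truncn (M / e)).+1.
apply/negP; rewrite -ltNge.
apply: (@lt_le_trans _ _ (e *+ (Num.truncn (M / e)).+1)).
  by rewrite -mulr_natr mulrC -ltr_pdivrMr// truncnS_gt.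
by rewrite -[X in _ *+ X]subn0 -sumr_const_nat; exact: ler_sum.
Qed.

Lemma expected_spreading_time_bounds (a b : R) : rates p a b ->
  exists2 E : R, expected_spreading_time P v0 X = E%:E &
    (a + b) * ln n%:R - 2 * (a + b / (1 - p)) <= E /\
    E <= (a + b) * ln n%:R + (3 * a / p + 2 * b / (1 - p) + 2 * (a + b / (1 - p))).
Proof.
move=> r; have a0 := growth_rate_gt0 r; have b0 := shrink_rate_gt0 r.
have n0 : (0 < n)%N := leq_ltn_trans (leq0n v0) (ltn_ord v0).
have ln0 : 0 <= ln n%:R :> R by rewrite ln_ge0// ler1n.
have us := upper_potential_start r n0; have ls := lower_potential_start r n0.
set c1 := 3 * a / p in us *; set c2 := 2 * b / (1 - p).
set D := 2 * (a + b / (1 - p)).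
pose M := (a + b) * ln n%:R + (c1 + c2 + D).
(* The lower bound of the upper potential holds in every state, so this bound is uniform in [t] and
   makes the expectation finite. *)
have up t : \sum_(0 <= s < t) tail s <= M.
  have dr := mean_drift_le t (fun u u0 un => upper_drift r u0 un).
  have lb : - a * ln n%:R - (c2 + D) <= mean t (upper_potential p a b n).
    rewrite -[leLHS](mean_cst v0 HX t); apply: ler_mean => u un.
    exact: upper_potential_ge.
  have := le_trans dr us; rewrite mulNr in lb; rewrite /M mulrDl.
  move: lb; clear dr us M.
  move: (a * _) (b * _) (mean _ _) (\sum_(_ <= _ < _) _) c1 c2 D.
  by move=> x1 x2 x3 x4 c1 c2 D; lra.
have ETs := expected_spreading_time_series.
have leM : (expected_spreading_time P v0 X <= M%:E)%E.
  by rewrite ETs; apply: nneseries_le_ub => // t; exact: tail_ge0.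
have geS t : ((\sum_(0 <= s < t) tail s)%:E <= expected_spreading_time P v0 X)%E.
  by rewrite ETs -sumEFin; apply: nneseries_lim_ge => s _ _; rewrite lee_fin tail_ge0.
have ETfin : expected_spreading_time P v0 X \is a fin_num.
  rewrite ge0_fin_numE; first exact: (le_lt_trans leM (ltry _)).
  by have := geS 0%N; rewrite big_geq.
exists (fine (expected_spreading_time P v0 X)); first by rewrite fineK.
move: leM geS; rewrite -(fineK ETfin) lee_fin; set E := fine _ => leM geS.
split; last exact: leM.
apply/ler_addgt0Pr => e e0.
(* This is the excess in [lower_potential_le]; the summand 1 keeps it positive when [n = 1]. A time
   [t] with [tail t * c < e] is then chosen. *)
pose c := (a + b) * ln n%:R + 1.
have c0 : 0 < c by rewrite /c ltr_wpDl// mulr_ge0// addr_ge0// ltW.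
have [t te] := tail_small up (divr_gt0 e0 c0).
rewrite ltr_pdivlMr// in te.
have dr := mean_drift_ge t (fun u u0 un => lower_drift r u0 un).
have ub : mean t (lower_potential p a b n) <= - a * ln n%:R + D + tail t * c.
  rewrite -[X in _ <= X + _](mean_cst v0 HX t) -(mean_tail P v0 X) -meanD.
  by apply: ler_mean => u un; exact: lower_potential_le.
have := le_trans ls dr; have := geS t; rewrite lee_fin mulrDl.
rewrite mulNr in ub; move: ub te; clear leM geS ls us up dr c0 M.
move: (tail t * c) (a * _) (b * _) (mean _ _) (\sum_(_ <= _ < _) _) E D.
by move=> x0 x1 x2 x3 x4 E D /=; lra.
Qed.

End Expectation.

Theorem theorem55 (R : realType) (p : R) (hp0 : 0 < p) (hp1 : p < 1) :
  exists (C : R) (N : nat),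
    forall (n : nat) (v0 : 'I_n) (d : measure_display) (T : measurableType d)
      (P : probability T R) (X : nat -> 'I_n -> T -> 'I_n * bool),
      (N <= n)%N -> pull_calls P p X ->
      (`| expected_spreading_time P v0 X
          - (ln n%:R / ln (1 + p) + 1 / ln (1 / (1 - p)) * ln n%:R)%:E |
        <= C%:E)%E.
Proof.
pose a := (ln (1 + p))^-1; pose b := 1 / ln (1 / (1 - p)).
have r : rates p a b.
  split => //; first by rewrite mulVf// gt_eqF// ln_gt0//; lra.
  rewrite /b !div1r lnV ?posrE; last by lra.
  by rewrite invrN mulNr mulVf// lt_eqF// ln_lt0//; lra.
(* The constant of the upper bound dominates that of the lower bound; [v0] already forces
   [n > 0]. *)
exists (3 * a / p + 2 * b / (1 - p) + 2 * (a + b / (1 - p))), 0%N.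
move=> n v0 d T P X _ HX; rewrite -/b [_ / ln (1 + p)]mulrC -/a -mulrDl.
have [c10 c20 D0] := rates_coef_gt0 r.
have [E -> [lo up]] := expected_spreading_time_bounds v0 HX r.
by rewrite -EFinB abse_EFin lee_fin ler_norml; apply/andP; split; lra.
Qed.
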